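(* Let $H = H_0\tau_z + H_M + \Delta'\tau_x + \Delta''\tau_y$ be a Bogoliubov–de Gennes Hamiltonian as defined in the context, with $H_0,\Delta',\Delta''$ Hermitian and time-reversal even and $H_M$ Hermitian and time-reversal odd. Suppose $H$ has energy gap $E_G>0$. If $H$ is not topologically trivial, then $\Delta'+H_M$ has an eigenvalue smaller than or equal to $-E_G$ and $\Delta'-H_M$ has an eigenvalue smaller than or equal to $-E_G$.
   Context: Fix an integer $d\ge 0$ (spatial dimension) and $N\ge 1$ (number of degrees of freedom per unit cell: orbital, spin, position within the cell, etc.). A translation-invariant (periodic) Hermitian operator on the $N$-dimensional internal space is a continuous map $A:\mathbb{T}^d\to\mathbb{C}^{N\times N}$ from the Brillouin torus $\mathbb{T}^d=(\mathbb{R}/2\pi\mathbb{Z})^d$ with $A(k)=A(k)^\dagger$ for all $k$ (for $d=0$ this is just a Hermitian matrix). An eigenvalue of $A$ means an eigenvalue of $A(k)$ for some $k$. Time reversal is an antiunitary operator $\mathcal{T}=VK$, with $V$ a fixed ($k$-independent) unitary $N\times N$ matrix, $K$ complex conjugation, and $\mathcal{T}^2=\pm1$. It acts by $(\mathcal{T}A\mathcal{T}^{-1})(k)=V\,\overline{A(-k)}\,V^{-1}$. $A$ is time-reversal even if $\mathcal{T}A\mathcal{T}^{-1}=A$ and time-reversal odd if $\mathcal{T}A\mathcal{T}^{-1}=-A$. $\tau_x,\tau_y,\tau_z$ are the Pauli matrices in particle-hole space $\mathbb{C}^2$; $A\tau_j$ means $\tau_j\otimes A$, and $A$ alone means $1_2\otimes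 A$. A BdG Hamiltonian is $H=H_0\tau_z+H_M+\Delta'\tau_x+\Delta''\tau_y$, with $H_0,\Delta',\Delta''$ translation-invariant Hermitian time-reversal even and $H_M$ translation-invariant Hermitian time-reversal odd. Equivalently, $H$ is a continuous family of Hermitian $2N\times 2N$ matrices with particle-hole symmetry $\mathcal{P}H\mathcal{P}^{-1}=-H$, where $\mathcal{P}=i\tau_y\mathcal{T}$. The energy gap of $H$ is $E_G=\min\{|E| : E \text{ an eigenvalue of } H(k) \text{ for some } k\in\mathbb{T}^d\}$; $H$ is gapped if $E_G>0$. A gapped $H$ is topologically trivial if there is a continuous path $s\mapsto H_s$, $s\in[0,1]$ (jointly continuous in $(s,k)$), of gapped BdG Hamiltonians, i.e. gapped Hamiltonians of the form $A_s\tau_z+B_s+C_s\tau_x+D_s\tau_y$ with $A_s,C_s,D_s$ translation-invariant Hermitian time-reversal even and $B_s$ translation-invariant Hermitian time-reversal odd (hence $\mathcal{P}$-symmetric), from $H$ at $s=0$ to the onsite potential $\tau_z\otimes 1_N$ at $s=1$; if in addition $H$ is time-reversal symmetric, i.e. $(1_2\otimes\mathcal{T})H(1_2\otimes\mathcal{T})^{-1}=H$ (equivalently $H_M=0$ and $\Delta''=0$), every Hamiltonian on the path is required to be so as well. *)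

(* Defs.v *)
From HB Require Import structures.
From mathcomp Require Import all_boot all_order all_algebra.
From mathcomp Require Import sesquilinear spectral.
From mathcomp Require Import all_classical all_reals all_analysis.
From mathcomp Require Import complex mxtens.

Set Implicit Arguments.
Unset Strict Implicit.
Unset Printing Implicit Defensive.

Import Order.TTheory GRing.Theory Num.Theory.
Import numFieldNormedType.Exports.

Local Open Scope classical_set_scope.
Local Open Scope complex_scope.
Local Open Scope ring_scope.

(* The instances exported by numFieldNormedType are keyed on the abstract
   projections of the number structures and do not fire on R[i]; this gives
   R[i] the usual topology, that of its modulus. *)
HB.instance Definition _ (R : rcfType) := NormedModule.copy R[i] R[i]^o.

(* A map on the torus (R / 2 pi Z)^d is represented by its lift to R^d, a
   function that is 2 pi-periodic in each coordinate; since the projection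
   R^d -> T^d is an open quotient map, continuity of the lift (also jointly
   with a parameter) is continuity on the torus. *)
Definition torus_periodic (R : realType) (d : nat) (T : Type)
    (A : 'rV[R]_d -> T) : Prop :=
  forall (k : 'rV[R]_d) (j : 'I_d), A (k + (2 * pi) *: delta_mx 0 j) = A k.

Definition translation_invariant_hermitian (R : realType) (d n : nat)
    (A : 'rV[R]_d -> 'M[R[i]]_n) : Prop :=
  [/\ torus_periodic A, continuous A & forall k, A k \is hermsymmx].

(* V is the unitary part of T = V K; the square of T is the matrix V times the
   entrywise conjugate of V. *)
Definition time_reversal (R : realType) (n : nat) (V : 'M[R[i]]_n) : Prop :=
  V \is unitarymx /\
  (V *m map_mx Num.conj V = 1%:M \/ V *m map_mx Num.conj V = - 1%:M).

(* Conjugation by the antiunitary V K, which also reverses the momentum. *)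
Definition tr_conj (R : realType) (d n : nat) (V : 'M[R[i]]_n)
    (A : 'rV[R]_d -> 'M[R[i]]_n) : 'rV[R]_d -> 'M[R[i]]_n :=
  fun k => V *m map_mx Num.conj (A (- k)) *m invmx V.

Definition tr_even (R : realType) (d n : nat) (V : 'M[R[i]]_n)
    (A : 'rV[R]_d -> 'M[R[i]]_n) : Prop :=
  forall k, tr_conj V A k = A k.

Definition tr_odd (R : realType) (d n : nat) (V : 'M[R[i]]_n)
    (A : 'rV[R]_d -> 'M[R[i]]_n) : Prop :=
  forall k, tr_conj V A k = - A k.

Definition mx22 (R : realType) (a b c d : R[i]) : 'M[R[i]]_2 :=
  \matrix_(i < 2, j < 2) (nth [::] [:: [:: a; b]; [:: c; d]] i)`_j.

Definition tau_x (R : realType) : 'M[R[i]]_2 := mx22 0 1 1 0.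
Definition tau_y (R : realType) : 'M[R[i]]_2 := mx22 0 (- 'i) 'i 0.
Definition tau_z (R : realType) : 'M[R[i]]_2 := mx22 1 0 0 (- 1).

Definition bdg (R : realType) (d n : nat)
    (H0 HM D1 D2 : 'rV[R]_d -> 'M[R[i]]_n) : 'rV[R]_d -> 'M[R[i]]_(2 * n) :=
  fun k => tensmx (tau_z R) (H0 k) + tensmx (1%:M : 'M[R[i]]_2) (HM k)
         + tensmx (tau_x R) (D1 k) + tensmx (tau_y R) (D2 k).

Definition bdg_data (R : realType) (d n : nat) (V : 'M[R[i]]_n)
    (H0 HM D1 D2 : 'rV[R]_d -> 'M[R[i]]_n) : Prop :=
  [/\ translation_invariant_hermitian H0 /\ tr_even V H0,
      translation_invariant_hermitian HM /\ tr_odd V HM,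
      translation_invariant_hermitian D1 /\ tr_even V D1
    & translation_invariant_hermitian D2 /\ tr_even V D2].

Definition bdg_hamiltonian (R : realType) (d n : nat) (V : 'M[R[i]]_n)
    (H : 'rV[R]_d -> 'M[R[i]]_(2 * n)) : Prop :=
  exists H0 HM D1 D2 : 'rV[R]_d -> 'M[R[i]]_n,
    bdg_data V H0 HM D1 D2 /\ forall k, H k = bdg H0 HM D1 D2 k.

Definition has_eigenvalue (R : realType) (d n : nat)
    (A : 'rV[R]_d -> 'M[R[i]]_n) (a : R[i]) : Prop :=
  exists k, eigenvalue (A k) a.

(* E = min {|a| : a an eigenvalue of H}, the minimum being attained. *)
Definition energy_gap (R : realType) (d n : nat)
    (H : 'rV[R]_d -> 'M[R[i]]_n) (E : R) : Prop :=
  (exists2 a, has_eigenvalue H a & `|a| = E%:C) /\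
  (forall a, has_eigenvalue H a -> E%:C <= `|a|).

Definition gapped (R : realType) (d n : nat)
    (H : 'rV[R]_d -> 'M[R[i]]_n) : Prop :=
  exists2 E : R, energy_gap H E & 0 < E.

Definition tr_symmetric (R : realType) (d n : nat) (V : 'M[R[i]]_n)
    (H : 'rV[R]_d -> 'M[R[i]]_(2 * n)) : Prop :=
  tr_even (tensmx (1%:M : 'M[R[i]]_2) V) H.

Definition topologically_trivial (R : realType) (d n : nat) (V : 'M[R[i]]_n)
    (H : 'rV[R]_d -> 'M[R[i]]_(2 * n)) : Prop :=
  exists Hs : R -> 'rV[R]_d -> 'M[R[i]]_(2 * n),
    [/\ {within `[0, 1] `*` setT,
           continuous (fun p : R * 'rV[R]_d => Hs p.1 p.2)},
        forall s : R, 0 <= s <= 1 -> bdg_hamiltonian V (Hs s) /\ gapped (Hs s),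
        forall k, Hs 0 k = H k,
        forall k, Hs 1 k = tensmx (tau_z R) (1%:M : 'M[R[i]]_n)
      & tr_symmetric V H -> forall s : R, 0 <= s <= 1 -> tr_symmetric V (Hs s)].

(* Main.v *)
(* Contrapositive.  Write X = tau_x (x) 1 and Z = tau_z (x) 1, and join H to Z by
   the path (1 - t) H + t X followed by the segment from X to Z; the latter is
   gapped because X and Z are anticommuting involutions.  On the first segment,
   let x be a zero mode of M = a H + b X, with a, b >= 0 not both zero.  From
   a x H = - b x X and H^2 >= EG^2 one gets b >= a EG; and since x (M X + X M) x^* = 0,
   x is isotropic for the Hermitian form a G + b, where 2 G = H X + X H.  In the
   eigenbasis of tau_x, G is the direct sum of D1 + HM and D1 - HM, so if neither
   has an eigenvalue <= - EG then a G + b > - a EG + b >= 0: a contradiction.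
   Time reversal maps the eigenvalues of D1 + HM to those of D1 - HM, so these two
   operators have eigenvalues <= - EG together or not at all. *)
Require Import Defs.
From mathcomp Require Import all_boot all_order all_algebra.
From mathcomp Require Import perm sesquilinear spectral.
From mathcomp Require Import all_classical all_reals all_analysis.
From mathcomp Require Import complex mxtens lra.

Set Implicit Arguments.
Unset Strict Implicit.
Unset Printing Implicit Defensive.

Import Order.TTheory GRing.Theory Num.Theory.
Import numFieldNormedType.Exports.
Local Open Scope classical_set_scope.
Local Open Scope complex_scope.
Local Open Scope sesquilinear_scope.
Local Open Scope ring_scope.

(** * Spectral decomposition and quadratic forms of Hermitian matrices *)

Lemma hermsymmxP (C : numClosedFieldType) n (A : 'M[C]_n) :
  reflect (A ^t* = A) (A \is hermsymmx).
Proof.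
rewrite is_hermitianmxE expr0 scale1r eq_sym; exact: eqP.
Qed.

Lemma eigenvalue_det (F : fieldType) n (A : 'M[F]_n) a :
  eigenvalue A a = (\det (A - a%:M) == 0).
Proof.
by rewrite /eigenvalue /eigenspace kermx_eq0 row_free_unit unitmxE unitfE negbK.
Qed.

Lemma dotmx_self_gt0 (C : numClosedFieldType) n (x : 'rV[C]_n) :
  x != 0 -> 0 < (x *m x ^t*) 0 0.
Proof.
move=> /rV0Pn[i xi0]; rewrite mxE (bigD1 i)//= !mxE ltr_wpDr//.
  by apply: sumr_ge0 => j _; rewrite !mxE mul_conjC_ge0.
by rewrite mul_conjC_gt0.
Qed.

(** The row [y] collects the coordinates of [x] in an orthonormal eigenbasis. All three forms share
    the weights [|y 0 i| ^+ 2], so inequalities between them reduce to inequalities on the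
    eigenvalues [d i]. *)
Lemma hermsymmx_forms (C : numClosedFieldType) n (A : 'M[C]_n) :
  A \is hermsymmx ->
  exists2 d : 'I_n -> C, (forall i, eigenvalue A (d i) /\ d i \is Num.real) &
  forall x : 'rV[C]_n, exists y : 'rV[C]_n,
    [/\ (x *m x ^t*) 0 0 = \sum_i `|y 0 i| ^+ 2,
        (x *m A *m x ^t*) 0 0 = \sum_i d i * `|y 0 i| ^+ 2 &
        (x *m A *m (x *m A) ^t*) 0 0 = \sum_i d i ^+ 2 * `|y 0 i| ^+ 2].
Proof.
move=> hA; have /orthomx_spectralP := hermitian_normalmx hA.
have /mxOverP dr := hermitian_spectral_diag_real hA.
have Pu := spectral_unitarymx A; have Pi := spectral_unit A.
move: dr Pu Pi; set P := spectralmx A; set D := spectral_diag A => dr Pu Pi AE.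
have PPt : P *m P ^t* = 1%:M by apply/unitarymxP.
have PtP : P ^t* *m P = 1%:M by rewrite -invmx_unitary// mulVmx.
exists (fun i => D 0 i) => [i|x].
  (* Row [i] of the unitary [P] is a left eigenvector; if it vanished, so would the [(i, i)] entry
     of [P *m P ^t*], which is 1. *)
  split=> //; apply/eigenvalueP; exists (row i P); last first.
    apply/eqP => Pi0; have := congr1 (row i) PPt.
    rewrite row_mul Pi0 mul0mx => /rowP/(_ i); rewrite !mxE eqxx => /eqP.
    by rewrite eq_sym oner_eq0.
  rewrite {1}AE invmx_unitary// !mulmxA -row_mul PPt -!row_mul mul1mx.
  by apply/rowP => j; rewrite !mxE; under eq_bigr do rewrite !mxE mulrnAl;
     rewrite (bigD1 i)//= eqxx mulr1n big1 ?addr0// => k /negPf ki;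
     rewrite eq_sym ki.
pose y := x *m P ^t*; exists y.
have xE : x = y *m P by rewrite /y -mulmxA PtP mulmx1.
have xAE : x *m A = (y *m diag_mx D) *m P.
  by rewrite xE {1}AE invmx_unitary// !mulmxA -(mulmxA y) PPt mulmx1.
have form (u v : 'rV[C]_n) : (u *m P) *m (v *m P) ^t* = u *m v ^t*.
  by rewrite trmx_mul map_mxM !mulmxA -(mulmxA u) PPt mulmx1.
have yDE i : (y *m diag_mx D) 0 i = D 0 i * y 0 i.
  by rewrite mul_mx_diag mxE mulrC.
split.
- by rewrite xE form mxE; apply: eq_bigr => i _; rewrite !mxE normCK.
- rewrite xAE xE form mxE; apply: eq_bigr => i _.
  by rewrite yDE !mxE -mulrA normCK.
- rewrite xAE form mxE; apply: eq_bigr => i _.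
  rewrite !yDE [_ i 0]mxE [_ i 0]mxE yDE rmorphM /= (CrealP (dr 0 i)) mulrACA -expr2.
  by rewrite normCK.
Qed.

Lemma hermsymmx_eigenvalue_real (C : numClosedFieldType) n (A : 'M[C]_n) a :
  A \is hermsymmx -> eigenvalue A a -> a \is Num.real.
Proof.
move=> /hermsymmxP hA /eigenvalueP[v vA v0].
have q0 := dotmx_self_gt0 v0.
have : (v *m A *m v ^t*) 0 0 = (v *m (v *m A) ^t*) 0 0.
  by rewrite trmx_mul map_mxM hA mulmxA.
rewrite vA linearZ/= map_mxZ -scalemxAl -scalemxAr mxE [RHS]mxE.
by move=> /(mulIf (lt0r_neq0 q0))/esym/CrealP.
Qed.

Lemma hermsymmx_form_gt (C : numClosedFieldType) n (A : 'M[C]_n) e (x : 'rV_n) :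
  A \is hermsymmx -> (forall a, eigenvalue A a -> e < a) -> x != 0 ->
  e * (x *m x ^t*) 0 0 < (x *m A *m x ^t*) 0 0.
Proof.
move=> hA eA x0; have [d /all_and2[dA _] /(_ x)[y [xx xAx _]]] := hermsymmx_forms hA.
have := dotmx_self_gt0 x0.
rewrite xx xAx -subr_gt0 mulr_sumr -sumrB => y0.
(* Strictness comes from one coordinate of positive weight, which exists because the weights have a
   positive sum. *)
have [i yi0] : exists i, y 0 i != 0.
  apply/existsP; apply: contraT => /existsPn y00; move: y0.
  by rewrite big1 ?ltxx// => i _; have /negPn/eqP-> := y00 i; rewrite normr0 expr0n.
rewrite (bigD1 i)//= ltr_wpDr//.
  apply: sumr_ge0 => j _; rewrite -mulrBl mulr_ge0 ?exprn_ge0// subr_ge0 ltW//.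
  exact: eA.
by rewrite -mulrBl mulr_gt0 ?subr_gt0 ?exprn_gt0 ?normr_gt0//; exact: eA.
Qed.

(** Each [d i] is real, so [d i ^+ 2] equals [|d i| ^+ 2] and the bound holds term by term in the
    eigenbasis. This is how [H^2 >= EG^2] enters the argument. *)
Lemma hermsymmx_mul_ge (C : numClosedFieldType) n (A : 'M[C]_n) e (x : 'rV_n) :
  A \is hermsymmx -> 0 <= e -> (forall a, eigenvalue A a -> e <= `|a|) ->
  e ^+ 2 * (x *m x ^t*) 0 0 <= (x *m A *m (x *m A) ^t*) 0 0.
Proof.
move=> hA e0 eA.
have [d /all_and2[dA dr] /(_ x)[y [-> _ ->]]] := hermsymmx_forms hA.
rewrite mulr_sumr; apply: ler_sum => i _; rewrite ler_wpM2r ?exprn_ge0//.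
by rewrite -(real_normK (dr i)) lerXn2r ?nnegrE//; exact: eA.
Qed.

(** * Invertibility criteria for the two segments of the path *)

Lemma anticomm_involution_inj (C : numClosedFieldType) n (X Z : 'M[C]_n) b c
    (x : 'rV_n) :
  b \is Num.real -> c \is Num.real -> (b != 0) || (c != 0) ->
  X *m X = 1%:M -> Z *m Z = 1%:M -> X *m Z = - (Z *m X) ->
  x *m (b *: X + c *: Z) = 0 -> x = 0.
Proof.
move=> br cr bc XX ZZ XZ L0.
(* Anticommutation cancels the cross terms, so the square is a scalar; it is nonzero because [b] and
   [c] are real and not both zero. *)
have LL : (b *: X + c *: Z) *m (b *: X + c *: Z) = (b ^+ 2 + c ^+ 2) *: 1%:M.
  rewrite mulmxDl !mulmxDr -!scalemxAl -!scalemxAr XX ZZ XZ !scalerA scalerN.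
  by rewrite (mulrC c b) -!expr2 addrA addrNK -scalerDl.
have /eqP : (b ^+ 2 + c ^+ 2) *: x = 0.
  by rewrite -[x in LHS]mulmx1 scalemxAr -LL mulmxA L0 mul0mx.
rewrite scaler_eq0 => /orP[|/eqP//].
rewrite paddr_eq0 ?real_exprn_even_ge0// !expf_eq0/=.
by case: eqP bc => //= _ /negPf->.
Qed.

Lemma trmxCZ (C : numClosedFieldType) m n a (A : 'M[C]_(m, n)) :
  a \is Num.real -> (a *: A) ^t* = a *: A ^t*.
Proof.
by move=> ar; apply/matrixP => i j; rewrite !mxE rmorphM /= (CrealP ar).
Qed.

(** The first segment in abstract form: [M] stands for the Hamiltonian, [e] for a lower bound on its
    gap, [G] for half of its anticommutator with the involution [X]. The inequality [a * e <= b] is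
    not assumed: it is forced by the existence of a null vector. *)
Lemma gap_shift_inj (C : numClosedFieldType) n (M X G : 'M[C]_n) (a b e : C)
    (x : 'rV_n) :
  M \is hermsymmx -> X \is hermsymmx -> G \is hermsymmx ->
  X *m X = 1%:M -> M *m X + X *m M = 2 *: G ->
  0 <= a -> 0 <= b -> a + b != 0 -> 0 <= e ->
  (forall l, eigenvalue M l -> e <= `|l|) ->
  (forall l, eigenvalue G l -> - e < l) ->
  x *m (a *: M + b *: X) = 0 -> x = 0.
Proof.
move=> hM hX hG XX MXG a0 b0 ab0 e0 eM eG xL; apply/eqP; apply: contraT => x0.
have q0 := dotmx_self_gt0 x0; set q := (_ *m _) 0 0 in q0.
have ar := ger0_real a0; have br := ger0_real b0.
have /hermsymmxP MT := hM; have /hermsymmxP XT := hX.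
(* The two sides of [a x M = - b x X] have the same squared norm, and the Hermitian involution [X]
   preserves the norm of [x]. *)
have : a ^+ 2 * (x *m M *m (x *m M) ^t*) 0 0 = b ^+ 2 * q.
  move: xL; rewrite mulmxDr -!scalemxAr => /addr0_eq h.
  have: (a *: (x *m M)) *m (a *: (x *m M)) ^t* = (b *: (x *m X)) *m (b *: (x *m X)) ^t*.
    by rewrite -h linearN/= map_mxN mulmxN mulNmx opprK.
  rewrite !trmxCZ// -!scalemxAl -!scalemxAr !scalerA.
  have -> : x *m X *m (x *m X) ^t* = x *m x ^t*.
    by rewrite trmx_mul map_mxM XT mulmxA -(mulmxA x) XX mulmx1.
  by move=> /rowP/(_ 0); rewrite mxE [RHS]mxE -!expr2.
have := hermsymmx_mul_ge x hM e0 eM; rewrite -/q => + ME.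
move=> /(ler_wpM2l (exprn_ge0 2 a0)); rewrite ME mulrA ler_pM2r// -exprMn.
rewrite ler_pXn2r ?nnegrE ?mulr_ge0// => aeb.
(* With [L = a M + b X], both [x L X x^*] and [x X L x^*] vanish, the second because [L] is
   Hermitian; and [L X + X L = 2 (a G + b)]. *)
have : 2 * (a * (x *m G *m x ^t*) 0 0 + b * q) = 0.
  have LT : (a *: M + b *: X) ^t* = a *: M + b *: X.
    by rewrite linearD map_mxD !trmxCZ// MT XT.
  have h1 : x *m (a *: M + b *: X) *m X *m x ^t* = 0 by rewrite xL !mul0mx.
  have h2 : x *m X *m (a *: M + b *: X) *m x ^t* = 0.
    have -> : x *m X *m (a *: M + b *: X) *m x ^t* =
              x *m X *m (x *m (a *: M + b *: X)) ^t*.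
      by rewrite trmx_mul map_mxM LT mulmxA.
    by rewrite xL linear0 map_mx0 mulmx0.
  have : x *m (2 *: (a *: G + b *: 1%:M)) *m x ^t* = 0.
    have -> : 2 *: (a *: G + b *: 1%:M) =
              (a *: M + b *: X) *m X + X *m (a *: M + b *: X).
      rewrite mulmxDl mulmxDr -!scalemxAl -!scalemxAr XX addrACA -scalerDr MXG.
      by rewrite -scalerDl -(mulr2n b) -(mulr_natl b) scalerDr !scalerA (mulrC a).
    by rewrite mulmxDr mulmxDl !mulmxA h1 h2 addr0.
  rewrite -scalemxAr mulmxDr -!scalemxAr -scalemxAl mulmxDl -!scalemxAl mulmx1.
  rewrite /q; move: (x *m G *m x ^t*) (x *m x ^t*) => u w.
  by move=> /rowP/(_ 0); rewrite !mxE.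
move/eqP; rewrite mulf_eq0 pnatr_eq0/=; apply/contraTT => _.
have := hermsymmx_form_gt hG eG x0; rewrite -/q.
(* Multiplying the strict bound on [G] by [a] keeps it strict only for [a > 0]; at [a = 0] the form
   is [b * q] with [b] nonzero. *)
have [a_eq0 _|a_neq0] := eqVneq a 0.
  by move: ab0; rewrite a_eq0 mul0r !add0r => b_neq0; rewrite mulf_neq0// gt_eqF.
have a_gt0 : 0 < a by rewrite lt_def a_neq0.
rewrite -(ltr_pM2l a_gt0) => agt; rewrite gt_eqF//.
apply: le_lt_trans (_ : - (a * e) * q + b * q < _).
  by rewrite -mulrDl mulr_ge0 ?(ltW q0)// addrC subr_ge0.
by rewrite ltrD2r mulNr -mulrA -mulrN -mulNr.
Qed.

(** * Continuity of matrix-valued maps *)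

Lemma mx_continuous (T U : topologicalType) m n (f : T -> 'M[U]_(m, n)) :
  (forall i j, continuous (fun t => f t i j)) -> continuous f.
Proof.
move=> cf t A [P Pn PA].
apply: filterS (_ : \forall s \near t, forall i j, P i j (f s i j)).
  by move=> s; exact: PA.
by apply: filter_forall => i; apply: filter_forall => j; apply: cf; exact: Pn.
Qed.

Lemma mx_entry_continuous (T U : topologicalType) m n (f : T -> 'M[U]_(m, n)) i j :
  continuous f -> continuous (fun t => f t i j).
Proof.
move=> cf t A Ant; apply: (cf t [set M | A (M i j)]).
(* This family of entrywise neighborhoods constrains the entry [(i, j)] alone and is the whole space
   elsewhere. *)
exists (fun k l => [set u | (k, l) = (i, j) -> A u]) => [k l|M]; last exact.
have [[-> ->]|ne] := pselect ((k, l) = (i, j)).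
  by apply: filterS Ant => u Au _.
by apply: filterS filterT => u _ /ne.
Qed.

Lemma det_continuous (K : numFieldType) (T : topologicalType) n (f : T -> 'M[K]_n) :
  continuous f -> continuous (fun t => \det (f t)).
Proof.
move=> cf; apply: continuous_big => [|s _ t]; first exact: add_continuous.
apply: (@continuousM K T (fun=> (-1) ^+ s) (fun t => \prod_i f t i (s i)) t).
  exact: cst_continuous.
move: t; apply: continuous_big => [|i _]; first exact: mul_continuous.
exact: mx_entry_continuous.
Qed.

Lemma real_complex_continuous (R : realType) : continuous (fun x : R => x%:C).
Proof.
move=> x A /nbhs_ballP[e /= e0 eA]; apply/nbhs_ballP.
have er := ger0_real (ltW e0).
(* Balls of [R[i]] have a radius in [R[i]]; being positive, [e] is real, and its real part is a
   radius in [R]. *)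
exists (complex.Re e) => /=; first by rewrite -ltcR RRe_real.
move=> y; rewrite -ball_normE /= => xy; apply: eA; rewrite -ball_normE /=.
by rewrite -rmorphB/= normc_def /= expr0n addr0 sqrtr_sqr -(RRe_real er) ltcR.
Qed.

(** * Periodicity, compactness and attainment of the energy gap *)

Lemma torus_periodic_fold (R : realType) d (T : Type) (A : 'rV[R]_d -> T)
    (k : 'rV[R]_d) :
  torus_periodic A ->
  exists2 k' : 'rV[R]_d, (forall i, k' 0 i \in `[0, 2 * pi]) & A k' = A k.
Proof.
move=> Aper; have pi2 : 0 < 2 * pi :> R by rewrite mulr_gt0 ?pi_gt0.
have AperZ q j (m : int) : A (q + (m%:~R * (2 * pi)) *: delta_mx 0 j) = A q.
  have Apern p (l : nat) : A (p + (l%:R * (2 * pi)) *: delta_mx 0 j) = A p.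
    elim: l => [|l IH]; first by rewrite mul0r scale0r addr0.
    by rewrite -natr1 mulrDl mul1r scalerDl addrA Aper.
  case: m => l; first exact: Apern.
  by rewrite -(Apern _ l.+1) -addrA -scalerDl -mulrDl NegzE rmorphN/= addNr mul0r
             scale0r addr0.
have Apers (m : 'I_d -> int) (s : seq 'I_d) q :
    A (q + \sum_(j <- s) ((m j)%:~R * (2 * pi)) *: delta_mx 0 j) = A q.
  elim: s q => [|j s IH] q; first by rewrite big_nil addr0.
  by rewrite big_cons addrA IH AperZ.
(* The floor counts the full periods in coordinate [j]; removing them moves [k] into the fundamental
   cube. *)
pose m j := - Num.floor (k 0 j / (2 * pi)).
exists (k + \sum_j ((m j)%:~R * (2 * pi)) *: delta_mx 0 j) => [i|]; last exact: Apers.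
rewrite mxE summxE (bigD1 i)//= big1 => [|j /negPf ji]; last first.
  by rewrite !mxE (eq_sym i) ji andbF mulr0.
rewrite !mxE !eqxx mulr1 addr0 rmorphN/= mulNr in_itv/=.
rewrite subr_ge0 lerBlDl -ler_pdivlMr// floor_le/=.
have -> : (Num.floor (k 0 i / (2 * pi)))%:~R * (2 * pi) + 2 * pi =
   (Num.floor (k 0 i / (2 * pi)) + 1)%:~R * (2 * pi) :> R.
  by rewrite intrD [RHS]mulrDl mul1r.
by rewrite -ler_pdivrMr// ltW// floorD1_gt.
Qed.

(** The point is that the minimum is attained. The pairs [(r, k)] with [r] an eigenvalue of [H k]
    form the zero set of a continuous determinant; cut down to bounded [r] and to the fundamental
    cube, this set is compact, so [|r|] has a minimum on it, which is positive because no [H k] has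
    a null vector. *)
Lemma torus_periodic_gapped (R : realType) d n (H : 'rV[R]_d -> 'M[R[i]]_n) :
  (0 < n)%N -> translation_invariant_hermitian H ->
  (forall k (x : 'rV_n), x *m H k = 0 -> x = 0) -> gapped H.
Proof.
move=> n_gt0 [Hper Hcont Hherm] Hinj.
have Hreal k a : eigenvalue (H k) a -> exists r : R, a = r%:C.
  by move=> /(hermsymmx_eigenvalue_real (Hherm k))/complex_realP.
pose S := [set p : R * 'rV[R]_d | \det (H p.2 - (p.1)%:C%:M) = 0].
have SE r k : S (r, k) = eigenvalue (H k) r%:C :> Prop.
  by rewrite /S/= eigenvalue_det; apply/propext; split=> /eqP.
have Sclosed : closed S.
  apply: (@closed_comp _ _ (fun p : R * 'rV[R]_d => \det (H p.2 - (p.1)%:C%:M)) [set 0]).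
    move=> p _; apply: det_continuous p; apply: mx_continuous => i j.
    have -> : (fun p : R * 'rV[R]_d => (H p.2 - (p.1)%:C%:M) i j) =
              (fun p => H p.2 i j - (p.1)%:C *+ (i == j)).
      by apply/funext => p; rewrite !mxE.
    move=> p; apply: (@continuousB R[i] R[i] _ (fun p => H p.2 i j)).
      apply: (@continuous_comp _ _ _ snd (fun k => H k i j)); first exact: cvg_snd.
      exact: mx_entry_continuous.
    case: (i == j); last exact: cst_continuous.
    apply: (@continuous_comp _ _ _ fst (fun x : R => x%:C)); first exact: cvg_fst.
    exact: real_complex_continuous.
  exact/accessible_closed_set1/hausdorff_accessible/norm_hausdorff.
(* Some eigenvalue exists because the matrices have positive size; its modulus [|r0|] bounds the
   interval of candidates and makes the compact set nonempty. *)
have [a a_ev] := eigenvalue_closed (H 0) n_gt0.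
have [r0 ar0] := Hreal _ _ a_ev; rewrite {}ar0 in a_ev.
pose B : set 'rV[R]_d := [set v | forall i, v 0 i \in `[0, 2 * pi]].
pose K := (`[- `|r0|, `|r0|] `*` B) `&` S.
have inK r k : eigenvalue (H k) r%:C -> `|r| <= `|r0| ->
    exists k', K (r, k').
  move=> ev rr0; have [k' k'B Hk'] := torus_periodic_fold k Hper.
  by exists k'; split; [split; rewrite //= in_itv/= -ler_norml|rewrite SE Hk'].
have Kcompact : compact K.
  apply: compact_closedI => //; apply: compact_setX; first exact: segment_compact.
  apply: (@rV_compact R d (fun=> `[0, 2 * pi]%classic)) => _.
  exact: segment_compact.
have K0 : K !=set0 by have [k' ?] := inK _ _ a_ev (lexx _); exists (r0, k').
have normc : {within K, continuous (fun p : R * 'rV[R]_d => `|p.1|)}.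
  apply: continuous_subspaceT => p.
  apply: (@continuous_comp _ _ _ fst (fun x : R => `|x|)); first exact: cvg_fst.
  exact: norm_continuous.
have [[r k]] := compact_EVT_min K0 Kcompact normc.
rewrite inE => -[_ rkS] rmin; rewrite SE in rkS.
exists `|r|; last first.
  rewrite normr_gt0; apply/eqP => r_eq0; have /eigenvalueP[v + v0] := rkS.
  by rewrite r_eq0 scale0r => /Hinj/eqP; apply/negP.
have normE (x : R) : `|x%:C| = `|x|%:C.
  by rewrite normc_def/= expr0n addr0 sqrtr_sqr.
split; first by exists r%:C; [exists k|exact: normE].
move=> b [k1 ev]; have [r1 br1] := Hreal _ _ ev; rewrite {}br1 in ev *.
rewrite normE lecR.
have [k' r0k'] := inK _ _ a_ev (lexx _).
have rr0 : `|r| <= `|r0| by apply: (rmin (r0, k')); rewrite inE.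
(* An eigenvalue outside the interval has modulus above [|r0|], hence above the minimum. *)
have [r10|/ltW r01] := leP `|r1| `|r0|; last exact: le_trans r01.
by have [k2 r1k2] := inK _ _ ev r10; apply: (rmin (r1, k2)); rewrite inE.
Qed.

(** * Kronecker products and their block components *)

Lemma tensmxDr (R : pzRingType) m n p q (A : 'M[R]_(m, n)) (B C : 'M[R]_(p, q)) :
  tensmx A (B + C) = tensmx A B + tensmx A C.
Proof. by apply/matrixP => i j; rewrite !mxE mulrDr. Qed.

Lemma tensmxZr (R : comPzRingType) m n p q a (A : 'M[R]_(m, n)) (B : 'M[R]_(p, q)) :
  tensmx A (a *: B) = a *: tensmx A B.
Proof. by apply/matrixP => i j; rewrite !mxE mulrCA. Qed.

Lemma tens1mx1 (R : pzRingType) m n : tensmx 1%:M 1%:M = 1%:M :> 'M[R]_(m * n).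
Proof.
apply/matrixP => i j; case: (mxtens_indexP i) => i0 i1; case: (mxtens_indexP j) => j0 j1.
rewrite tensmxE !mxE -natrM mulnb (inj_eq (can_inj (@mxtens_indexK _ _))).
by rewrite xpair_eqE.
Qed.

Lemma hermsymmx_tens (C : numClosedFieldType) m n (A : 'M[C]_m) (B : 'M[C]_n) :
  A \is hermsymmx -> B \is hermsymmx -> tensmx A B \is hermsymmx.
Proof.
move=> /hermsymmxP hA /hermsymmxP hB; apply/hermsymmxP.
by rewrite trmx_tens map_mxT hA hB.
Qed.

Lemma hermsymmxD (C : numClosedFieldType) n (A B : 'M[C]_n) :
  A \is hermsymmx -> B \is hermsymmx -> A + B \is hermsymmx.
Proof.
move=> /hermsymmxP hA /hermsymmxP hB; apply/hermsymmxP.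
by rewrite linearD map_mxD hA hB.
Qed.

Lemma hermsymmx_scalar (C : numClosedFieldType) n (a : C) :
  a \is Num.real -> (a%:M : 'M[C]_n) \is hermsymmx.
Proof.
move=> ar; apply/hermsymmxP; rewrite tr_scalar_mx; apply/matrixP => i j.
by rewrite !mxE rmorphMn /= (CrealP ar).
Qed.

(** For [m = 2] the two slices are the particle and hole components of a Nambu vector. *)
Definition tens_slice (R : pzRingType) m n (x : 'rV[R]_(m * n)) (i : 'I_m) : 'rV_n :=
  \row_j x 0 (mxtens_index (i, j)).

Lemma tens_slice_mul (R : comPzRingType) m n (x : 'rV[R]_(m * n))
    (A : 'M[R]_m) (B : 'M[R]_n) i :
  tens_slice (x *m tensmx A B) i = \sum_k A k i *: (tens_slice x k *m B).
Proof.
apply/rowP => j; rewrite summxE !mxE.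
rewrite (reindex (@mxtens_index m n)) /=; last first.
  by exists (@mxtens_unindex m n) => ? _; rewrite ?mxtens_indexK ?mxtens_unindexK.
transitivity (\sum_k \sum_l x 0 (mxtens_index (k, l)) * (A k i * B l j)).
  rewrite pair_big /=; apply: eq_bigr => -[k l] _ /=; by rewrite tensmxE.
apply: eq_bigr => k _; rewrite !mxE mulr_sumr; apply: eq_bigr => l _.
by rewrite !mxE mulrCA.
Qed.

Lemma tens_slice_eq0 (R : pzRingType) m n (x : 'rV[R]_(m * n)) :
  (forall i, tens_slice x i = 0) -> x = 0.
Proof.
move=> x0; apply/rowP => k; case: (mxtens_indexP k) => i j.
by have /rowP/(_ j) := x0 i; rewrite !mxE.
Qed.

(** * Pauli matrices and the block decomposition along [tau_x] *)

Section Pauli.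
Variable R : realType.

Lemma tau_xx : tau_x R *m tau_x R = 1%:M.
Proof.
apply/matrixP => i j; rewrite !mxE !big_ord_recl big_ord0 !mxE.
by case: i j => -[|[|//]] ? [[|[|//]] ?] /=; rewrite ?(mulr0, mul0r, mulr1, addr0, add0r).
Qed.

Lemma tau_zz : tau_z R *m tau_z R = 1%:M.
Proof.
apply/matrixP => i j; rewrite !mxE !big_ord_recl big_ord0 !mxE.
by case: i j => -[|[|//]] ? [[|[|//]] ?] /=;
   rewrite ?(mulr0, mul0r, mulrNN, mulr1, addr0, add0r).
Qed.

Lemma tau_xz : tau_x R *m tau_z R = - (tau_z R *m tau_x R).
Proof.
apply/matrixP => i j; rewrite !mxE !big_ord_recl !big_ord0 !mxE.
by case: i j => -[|[|//]] ? [[|[|//]] ?] /=;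
   rewrite ?(mulr0, mul0r, mulr1, mul1r, mulrN, mulNr, addr0, add0r, oppr0, opprK).
Qed.

Lemma tau_xy : tau_x R *m tau_y R = - (tau_y R *m tau_x R).
Proof.
apply/matrixP => i j; rewrite !mxE !big_ord_recl !big_ord0 !mxE.
by case: i j => -[|[|//]] ? [[|[|//]] ?] /=;
   rewrite ?(mulr0, mul0r, mulr1, mul1r, mulrN, mulNr, addr0, add0r, oppr0, opprK).
Qed.

Lemma tau_x_herm : tau_x R \is hermsymmx.
Proof.
apply/hermsymmxP/matrixP => i j; rewrite !mxE.
by case: i j => -[|[|//]] ? [[|[|//]] ?] /=; rewrite ?(rmorph0, rmorph1).
Qed.

Lemma tau_y_herm : tau_y R \is hermsymmx.
Proof.
apply/hermsymmxP/matrixP => i j; rewrite !mxE.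
by case: i j => -[|[|//]] ? [[|[|//]] ?] /=;
   rewrite ?(rmorph0, rmorphN) ?complexiE /= ?(conjCi, opprK).
Qed.

Lemma tau_z_herm : tau_z R \is hermsymmx.
Proof.
apply/hermsymmxP/matrixP => i j; rewrite !mxE.
by case: i j => -[|[|//]] ? [[|[|//]] ?] /=; rewrite ?(rmorph0, rmorphN, rmorph1).
Qed.

Lemma tau_x_real : map_mx Num.conj (tau_x R) = tau_x R.
Proof.
apply/matrixP => i j; rewrite !mxE.
by case: i j => -[|[|//]] ? [[|[|//]] ?] /=; rewrite ?(rmorph0, rmorph1).
Qed.

Lemma tau_z_real : map_mx Num.conj (tau_z R) = tau_z R.
Proof.
apply/matrixP => i j; rewrite !mxE.
by case: i j => -[|[|//]] ? [[|[|//]] ?] /=; rewrite ?(rmorph0, rmorphN, rmorph1).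
Qed.

End Pauli.

(** Passing to the eigenbasis of [tau_x] means taking the sum and difference of the slices [u] and
    [v]: [u + v] satisfies the eigenvalue equation of [B + A], and [u - v] that of [B - A]. They
    cannot both vanish, since then [x = 0]. *)
Lemma eigenvalue_tau_x_block (R : realType) n (A B : 'M[R[i]]_n) l :
  eigenvalue (tensmx (tau_x R) A + tensmx 1%:M B) l ->
  eigenvalue (B + A) l \/ eigenvalue (B - A) l.
Proof.
move=> /eigenvalueP[x xG x0].
pose u := tens_slice x 0; pose v := tens_slice x 1.
have sD (y z : 'rV[R[i]]_(2 * n)) i :
    tens_slice (y + z) i = tens_slice y i + tens_slice z i.
  by apply/rowP => j; rewrite !mxE.
have sZ i : tens_slice (l *: x) i = l *: tens_slice x i.
  by apply/rowP => j; rewrite !mxE.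
have eu : v *m A + u *m B = l *: u.
  rewrite -sZ -xG mulmxDr sD !tens_slice_mul !big_ord_recl !big_ord0 !mxE /=.
  rewrite !(scale0r, scale1r, add0r, addr0).
  by congr (tens_slice x _ *m _ + _); exact: val_inj.
have ev : u *m A + v *m B = l *: v.
  rewrite -sZ -xG mulmxDr sD !tens_slice_mul !big_ord_recl !big_ord0 !mxE /=.
  rewrite !(scale0r, scale1r, add0r, addr0).
  by congr (_ + tens_slice x _ *m _); exact: val_inj.
have [uv0|uv0] := eqVneq (u + v) 0; last first.
  left; apply/eigenvalueP; exists (u + v) => //.
  rewrite scalerDr -eu -ev mulmxDr !mulmxDl [v *m A + u *m B]addrC.
  by rewrite [u *m A + v *m B]addrC [RHS]addrACA [v *m A + u *m A]addrC.
right; apply/eigenvalueP; exists (u - v).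
  rewrite scalerBr -eu -ev mulmxBr !mulmxBl opprB [v *m A + u *m B]addrC.
  by rewrite opprD [- _ - v *m B]addrC [RHS]addrACA.
apply: contra x0 => /eqP/subr0_eq uv; apply/eqP/tens_slice_eq0.
move: uv0; rewrite -uv -mulr2n -scaler_nat => /eqP.
rewrite scaler_eq0 pnatr_eq0/= => /eqP u0 i.
case: i => -[|[|//]] ilt; [rewrite -[RHS]u0|rewrite -[RHS]u0 uv];
  congr tens_slice; exact: val_inj.
Qed.

(** * Affine deformations of Bogoliubov-de Gennes Hamiltonians *)

Lemma real_complex_real (R : realType) (r : R) : r%:C \is Num.real.
Proof. by apply/complex_realP; exists r. Qed.

Lemma mx_continuousD (K : numFieldType) (T : topologicalType) m n
    (f g : T -> 'M[K]_(m, n)) :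
  continuous f -> continuous g -> continuous (fun t => f t + g t).
Proof.
move=> cf cg; apply: mx_continuous => i j.
have -> : (fun t => (f t + g t) i j) = (fun t => f t i j + g t i j).
  by apply/funext => t; rewrite mxE.
have fij : continuous (fun t => f t i j) by exact: mx_entry_continuous.
have gij : continuous (fun t => g t i j) by exact: mx_entry_continuous.
by move=> t; exact: continuousD (fij t) (gij t).
Qed.

(** Along the path every coefficient of the Hamiltonian has this shape: all four are scaled by the
    same [a], and those of [tau_x] and [tau_z] also receive a multiple of the identity. *)
Definition affine (R : realType) d n (a t : R) (A : 'rV[R]_d -> 'M[R[i]]_n) :
  'rV[R]_d -> 'M[R[i]]_n := fun k => a%:C *: A k + t%:C%:M.

Lemma affine0 (R : realType) d n (a : R) (A : 'rV[R]_d -> 'M[R[i]]_n) k :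
  affine a 0 A k = a%:C *: A k.
Proof. by rewrite /affine !rmorph0 addr0. Qed.

(** Letting parameters and momentum depend on a point of any space [T] covers both continuity in [k]
    at fixed parameters and joint continuity in [(s, k)]. *)
Lemma affine_continuous (R : realType) (T : topologicalType) d n (a t : T -> R)
    (h : T -> 'rV[R]_d) (A : 'rV[R]_d -> 'M[R[i]]_n) :
  continuous a -> continuous t -> continuous h -> continuous A ->
  continuous (fun p => affine (a p) (t p) A (h p)).
Proof.
move=> ca ct ch cA; apply: mx_continuous => i j.
have -> : (fun p => affine (a p) (t p) A (h p) i j) =
          (fun p => (a p)%:C * A (h p) i j + (t p)%:C *+ (i == j)).
  by apply/funext => p; rewrite !mxE.
have cC (f : T -> R) : continuous f -> continuous (fun p => (f p)%:C).
  by move=> cf p; apply: continuous_comp (cf p) _; exact: real_complex_continuous.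
move=> p; apply: (@continuousD R[i] R[i] _ (fun p => (a p)%:C * A (h p) i j)).
  apply: (@continuousM R[i] _ (fun p => (a p)%:C)); first exact: cC.
  apply: (@continuous_comp _ _ _ h (fun k => A k i j)); first exact: ch.
  exact: mx_entry_continuous.
case: (i == j); last exact: cst_continuous.
exact: cC.
Qed.

Lemma bdg_continuous (R : realType) (T : topologicalType) d n (h : T -> 'rV[R]_d)
    (A B C D : T -> 'rV[R]_d -> 'M[R[i]]_n) :
  continuous (fun p => A p (h p)) -> continuous (fun p => B p (h p)) ->
  continuous (fun p => C p (h p)) -> continuous (fun p => D p (h p)) ->
  continuous (fun p => bdg (A p) (B p) (C p) (D p) (h p)).
Proof.
have cT (s : 'M[R[i]]_2) (F : T -> 'M[R[i]]_n) : continuous F ->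
    continuous (fun p => tensmx s (F p)).
  move=> cF; apply: mx_continuous => i j.
  under eq_fun do rewrite mxE.
  move=> p; apply: (@continuousM R[i] _ (fun=> _)); first exact: cst_continuous.
  exact: mx_entry_continuous.
move=> cA cB cC cE; apply: (mx_continuousD _ (cT _ _ cE)).
apply: (mx_continuousD _ (cT _ _ cC)).
exact: (mx_continuousD (cT _ _ cA) (cT _ _ cB)).
Qed.

Lemma translation_invariant_hermitian_affine (R : realType) d n a t
    (A : 'rV[R]_d -> 'M[R[i]]_n) :
  translation_invariant_hermitian A ->
  translation_invariant_hermitian (affine a t A).
Proof.
move=> [Aper Acont Aherm]; split.
- by move=> k j; rewrite /affine Aper.
- have cst (c : R) : continuous (fun _ : 'rV[R]_d => c).
    exact: cst_continuous.
  have cid : continuous (fun k : 'rV[R]_d => k) by move=> k B; exact.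
  exact: (affine_continuous (cst a) (cst t) cid Acont).
- move=> k; apply: hermsymmxD; last exact/hermsymmx_scalar/real_complex_real.
  by apply/hermsymmxP; rewrite trmxCZ ?real_complex_real//; congr (_ *: _);
     apply/hermsymmxP.
Qed.

Lemma bdg_translation_invariant_hermitian (R : realType) d n
    (A B C D : 'rV[R]_d -> 'M[R[i]]_n) :
  translation_invariant_hermitian A -> translation_invariant_hermitian B ->
  translation_invariant_hermitian C -> translation_invariant_hermitian D ->
  translation_invariant_hermitian (bdg A B C D).
Proof.
move=> [Ap Ac Ah] [Bp Bc Bh] [Cp Cc Ch] [Dp Dc Dh]; split.
- by move=> k j; rewrite /bdg Ap Bp Cp Dp.
- exact (@bdg_continuous R _ d n id (fun=> A) (fun=> B) (fun=> C) (fun=> D) Ac Bc Cc Dc).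
- move=> k; rewrite !hermsymmxD// hermsymmx_tens//.
  + exact: tau_z_herm.
  + by apply: hermsymmx_scalar; rewrite realE ler01.
  + exact: tau_x_herm.
  + exact: tau_y_herm.
Qed.

Lemma map_conjZ (C : numClosedFieldType) m n a (A : 'M[C]_(m, n)) :
  a \is Num.real -> map_mx Num.conj (a *: A) = a *: map_mx Num.conj A.
Proof.
by move=> ar; apply/matrixP => i j; rewrite !mxE rmorphM /= (CrealP ar).
Qed.

(** The condition on [M] says that this constant matrix commutes with the antiunitary [V K]. It
    serves for real scalar matrices, and, with [tensmx 1%:M V] as the unitary part, for real
    combinations of [X] and [Z]. *)
Lemma tr_conj_comb (R : realType) d n (V M : 'M[R[i]]_n) a
    (A : 'rV[R]_d -> 'M[R[i]]_n) k :
  V \in unitmx -> V *m map_mx Num.conj M = M *m V ->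
  tr_conj V (fun k => a%:C *: A k + M) k = a%:C *: tr_conj V A k + M.
Proof.
move=> Vu VM; rewrite /tr_conj map_mxD map_conjZ ?real_complex_real//.
by rewrite mulmxDr mulmxDl VM mulmxK// -scalemxAr -scalemxAl.
Qed.

Lemma tr_conj_affine (R : realType) d n (V : 'M[R[i]]_n) a t
    (A : 'rV[R]_d -> 'M[R[i]]_n) k :
  V \in unitmx -> tr_conj V (affine a t A) k = a%:C *: tr_conj V A k + t%:C%:M.
Proof.
move=> Vu; apply: tr_conj_comb => //.
rewrite -[t%:C%:M]scalemx1 map_conjZ ?real_complex_real// map_mx1.
by rewrite -scalemxAr -scalemxAl mulmx1 mul1mx.
Qed.

(** Real multiples of the identity are Hermitian and time-reversal even, so they may be added to
    [H0] and [D1], while the odd [HM] can only be rescaled. *)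
Lemma bdg_data_affine (R : realType) d n (V : 'M[R[i]]_n)
    (H0 HM D1 D2 : 'rV[R]_d -> 'M[R[i]]_n) a b c :
  V \in unitmx -> bdg_data V H0 HM D1 D2 ->
  bdg_data V (affine a c H0) (affine a 0 HM) (affine a b D1) (affine a 0 D2).
Proof.
move=> Vu [[h0 e0] [hM oM] [h1 e1] [h2 e2]].
split; split; try exact: translation_invariant_hermitian_affine.
- by move=> k; rewrite tr_conj_affine// e0.
- by move=> k; rewrite tr_conj_affine// oM affine0 scalerN !rmorph0 addr0.
- by move=> k; rewrite tr_conj_affine// e1.
- by move=> k; rewrite tr_conj_affine// e2.
Qed.

Lemma bdg_affineE (R : realType) d n (H0 HM D1 D2 : 'rV[R]_d -> 'M[R[i]]_n) a b c k :
  bdg (affine a c H0) (affine a 0 HM) (affine a b D1) (affine a 0 D2) k =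
  a%:C *: bdg H0 HM D1 D2 k +
  (b%:C *: tensmx (tau_x R) 1%:M + c%:C *: tensmx (tau_z R) 1%:M).
Proof.
rewrite /bdg !affine0 /affine -[b%:C%:M]scalemx1 -[c%:C%:M]scalemx1.
rewrite !tensmxDr !tensmxZr !scalerDr [X in X + (_ + _) + _]addrAC.
by rewrite [X in X + _ = _]addrACA [LHS]addrAC [X in _ + X = _]addrC.
Qed.

(** * Time reversal and eigenvalues *)

Lemma eigenvalue_antiunitary (R : realType) n (V A : 'M[R[i]]_n) l :
  V \in unitmx -> eigenvalue A l ->
  eigenvalue (V *m map_mx Num.conj A *m invmx V) l^*.
Proof.
move=> Vu /eigenvalueP[v vA v0]; apply/eigenvalueP.
exists (map_mx Num.conj v *m invmx V).
  by rewrite !mulmxA mulmxKV// -map_mxM vA map_mxZ scalemxAl.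
apply: contra v0 => /eqP/(congr1 (mulmx^~ V)); rewrite mulmxKV// mul0mx => /eqP.
by rewrite map_mx_eq0.
Qed.

(** Conjugating [A k + B k] by [V K] gives [A - B] at the momentum [- k], and the complex
    conjugation of the eigenvalue is harmless because [l] is real. *)
Lemma tr_partner_eigenvalue (R : realType) d n (V : 'M[R[i]]_n)
    (A B : 'rV[R]_d -> 'M[R[i]]_n) l :
  V \in unitmx -> tr_even V A -> tr_odd V B -> l \is Num.real ->
  has_eigenvalue (fun k => A k + B k) l -> has_eigenvalue (fun k => A k - B k) l.
Proof.
move=> Vu eA oB lr [k /(eigenvalue_antiunitary Vu)]; rewrite (CrealP lr) => ev.
exists (- k); rewrite -eA -oB /tr_conj opprK -mulmxDl -mulmxDr -map_mxD.
exact: ev.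
Qed.

(** * Absence of zero modes along the path *)

Lemma bdg_tau_x_anticomm (R : realType) d n (H0 HM D1 D2 : 'rV[R]_d -> 'M[R[i]]_n) k :
  let X := tensmx (tau_x R) 1%:M in
  bdg H0 HM D1 D2 k *m X + X *m bdg H0 HM D1 D2 k =
  2 *: (tensmx (tau_x R) (HM k) + tensmx 1%:M (D1 k)).
Proof.
move=> X; rewrite /X /bdg !mulmxDl !mulmxDr !tensmx_mul !(mulmx1, mul1mx).
(* Since [tau_z] and [tau_y] anticommute with [tau_x], the terms in [H0] and [D2] cancel; those in
   [HM] and [D1] commute with [X] and double. *)
rewrite tau_xx tau_xz tau_xy.
have tN (A : 'M[R[i]]_2) (B : 'M[R[i]]_n) : tensmx (- A) B = - tensmx A B.
  by apply/matrixP => i j; rewrite !mxE mulNr.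
rewrite !tN -[2%:R]natr1 scalerDl scale1r.
rewrite addrACA subrr addr0 addrACA [X in X + _ = _]addrACA subrr add0r.
by rewrite addrACA.
Qed.

(** The constraint [a * c = 0] selects one of the two segments: [a = 0] leaves a combination of the
    anticommuting involutions [X] and [Z], and [c = 0] is the case of [gap_shift_inj]. The weights
    sum to 1, so they never vanish together. *)
Lemma bdg_path_inj (R : realType) d n (H0 HM D1 D2 : 'rV[R]_d -> 'M[R[i]]_n)
    (E a b c : R) k (x : 'rV_(2 * n)) :
  let H := bdg H0 HM D1 D2 in
  translation_invariant_hermitian HM -> translation_invariant_hermitian D1 ->
  H k \is hermsymmx ->
  0 <= E -> (forall l, eigenvalue (H k) l -> E%:C <= `|l|) ->
  (forall l, eigenvalue (D1 k + HM k) l -> ~~ (l <= (- E)%:C)) ->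
  (forall l, eigenvalue (D1 k - HM k) l -> ~~ (l <= (- E)%:C)) ->
  0 <= a -> 0 <= b -> a * c = 0 -> a + b + c = 1 ->
  x *m (a%:C *: H k + (b%:C *: tensmx (tau_x R) 1%:M + c%:C *: tensmx (tau_z R) 1%:M))
    = 0 -> x = 0.
Proof.
move=> H [_ _ hM] [_ _ h1] hH E0 EH Ep Em a0 b0 ac0 abc.
set X := tensmx (tau_x R) 1%:M; set Z := tensmx (tau_z R) 1%:M.
have XX : X *m X = 1%:M by rewrite tensmx_mul tau_xx mulmx1 tens1mx1.
have ZZ : Z *m Z = 1%:M by rewrite tensmx_mul tau_zz mulmx1 tens1mx1.
have XZ : X *m Z = - (Z *m X).
  by rewrite !tensmx_mul tau_xz; apply/matrixP => i j; rewrite !mxE mulNr.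
have h11 m : (1%:M : 'M[R[i]]_m) \is hermsymmx.
  by apply: hermsymmx_scalar; rewrite realE ler01.
have hX : X \is hermsymmx by rewrite hermsymmx_tens ?tau_x_herm.
have hG : tensmx (tau_x R) (HM k) + tensmx 1%:M (D1 k) \is hermsymmx.
  by rewrite hermsymmxD// hermsymmx_tens// tau_x_herm.
move/eqP: ac0; rewrite mulf_eq0 => /orP[] /eqP z0.
  rewrite z0 rmorph0 scale0r add0r.
  apply: anticomm_involution_inj => //; try exact: real_complex_real.
  rewrite -[0]/(0%:C) !(inj_eq (@complexI R)) -negb_and.
  by apply/negP => /andP[/eqP bz /eqP cz]; move/eqP: abc;
     rewrite z0 bz cz !addr0 eq_sym oner_eq0.
rewrite z0 rmorph0 scale0r addr0.
apply: (gap_shift_inj hH hX hG XX (bdg_tau_x_anticomm _ _ _ _ _) (e := E%:C)).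
- by rewrite ler0c.
- by rewrite ler0c.
- by rewrite -rmorphD/= -[a + b]addr0 -z0 abc oner_eq0.
- by rewrite ler0c.
- exact: EH.
(* The order on [R[i]] is partial; reality of the eigenvalue is what turns the negated inequality
   into a strict one. *)
- move=> l ev; have lr := hermsymmx_eigenvalue_real hG ev.
  rewrite -rmorphN/= real_ltNge ?real_complex_real//.
  by case/eigenvalue_tau_x_block: ev => ev; [exact: Ep|exact: Em].
Qed.

(** * The explicit path to the onsite potential *)

Lemma topologically_trivial_bdg (R : realType) (d N : nat) (N_gt0 : (0 < N)%N)
    (V : 'M[R[i]]_N) (H0 HM D1 D2 : 'rV[R]_d -> 'M[R[i]]_N) (E : R) :
  V \in unitmx -> bdg_data V H0 HM D1 D2 -> 0 <= E ->
  (forall l, has_eigenvalue (bdg H0 HM D1 D2) l -> E%:C <= `|l|) ->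
  (forall l, has_eigenvalue (fun k => D1 k + HM k) l -> ~~ (l <= (- E)%:C)) ->
  (forall l, has_eigenvalue (fun k => D1 k - HM k) l -> ~~ (l <= (- E)%:C)) ->
  topologically_trivial V (bdg H0 HM D1 D2).
Proof.
move=> Vu Hdata E0 EH Ep Em.
(* The weights [(a, b, c)] of [H], [X] and [Z] are [(1, 0, 0)] at [s = 0], [(0, 1, 0)] at [s = 1/2]
   and [(0, 0, 1)] at [s = 1], affine in between. Writing them with a maximum makes them continuous
   without gluing two segments. *)
pose ramp (u v s : R) := Num.max 0 (u + v * s).
pose a := ramp 1 (- 2); pose c := ramp (- 1) 2; pose b s := 1 - a s - c s.
have cramp u v : continuous (ramp u v).
  have caff : continuous (fun s : R => u + v * s).
    move=> s; apply: (@continuousD R R _ (fun=> u)); first exact: cst_continuous.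
    by apply: (@continuousM R _ (fun=> v)); [exact: cst_continuous|move=> A; exact].
  have c0 : continuous (fun _ : R => 0 : R) by exact: cst_continuous.
  move=> s; exact (@continuous_max R R _ _ s (c0 s) (caff s)).
have ca : continuous a by exact: cramp.
have cc : continuous c by exact: cramp.
have cb : continuous b.
  move=> s; apply: (@continuousB R R _ (fun s => 1 - a s)); last exact: cc.
  by apply: (@continuousB R R _ (fun=> 1)); [exact: cst_continuous|exact: ca].
have data s := bdg_data_affine (a s) (b s) (c s) Vu Hdata.
have [[t0 _] [tM _] [t1 _] [t2 _]] := Hdata.
have tH := bdg_translation_invariant_hermitian t0 tM t1 t2.
exists (fun s => bdg (affine (a s) (c s) H0) (affine (a s) 0 HM)
                     (affine (a s) (b s) D1) (affine (a s) 0 D2)).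
split.
- have c0 : continuous (fun _ : R => 0 : R) by exact: cst_continuous.
  have caff (f g : R -> R) (A : 'rV[R]_d -> 'M[R[i]]_N) :
      continuous f -> continuous g -> continuous A ->
      continuous (fun p : R * 'rV[R]_d => affine (f p.1) (g p.1) A p.2).
    move=> cf cg cA.
    have cfst (h : R -> R) : continuous h -> continuous (fun p : R * 'rV[R]_d => h p.1).
      by move=> ch p; apply: continuous_comp (ch p.1); exact: cvg_fst.
    have csnd : continuous (fun p : R * 'rV[R]_d => p.2) by move=> p; exact: cvg_snd.
    exact (affine_continuous (cfst _ cf) (cfst _ cg) csnd cA).
  move: t0 tM t1 t2 => [_ k0 _] [_ kM _] [_ k1 _] [_ k2 _].
  apply: continuous_subspaceT.
  exact (bdg_continuous (caff _ _ _ ca cc k0) (caff _ _ _ ca c0 kM)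
                        (caff _ _ _ ca cb k1) (caff _ _ _ ca c0 k2)).
- move=> s /andP[s0 s1]; split; first by do 4 eexists; split; [exact: data|].
  have [[u0 _] [uM _] [u1 _] [u2 _]] := data s.
  apply: torus_periodic_gapped; first by rewrite muln_gt0.
    exact: bdg_translation_invariant_hermitian.
  move=> k x; rewrite bdg_affineE; have [_ _ hH] := tH.
  apply: (bdg_path_inj tM t1 (hH k) E0).
  + by move=> l ev; apply: EH; exists k.
  + by move=> l ev; apply: Ep; exists k.
  + by move=> l ev; apply: Em; exists k.
  + by rewrite le_max lexx.
  + rewrite /b /a /c /ramp.
    by case: (leP 0 (1 + _)) => ?; case: (leP 0 (- 1 + _)) => ?; lra.
  + rewrite /a /c /ramp; case: (leP 0 (1 + _)) => ?; last by rewrite mul0r.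
    case: leP => ?; last by rewrite mulr0.
    (* Both ramps have a nonnegative affine part only at [s = 1/2], where [a] vanishes. *)
    have -> : 1 + - 2 * s = 0 by lra.
    by rewrite mul0r.
  + by rewrite /b -addrA addrNK addrC addrNK.
- move=> k; rewrite bdg_affineE.
  have -> : c 0 = 0 by rewrite /c /ramp; case: leP => ?; lra.
  have -> : b 0 = 0 by rewrite /b /a /c /ramp; do 2 case: leP => ?; lra.
  have -> : a 0 = 1 by rewrite /a /ramp; case: leP => ?; lra.
  by rewrite !scale0r !addr0 scale1r.
- move=> k; rewrite bdg_affineE.
  have -> : c 1 = 1 by rewrite /c /ramp; case: leP => ?; lra.
  have -> : b 1 = 0 by rewrite /b /a /c /ramp; do 2 case: leP => ?; lra.
  have -> : a 1 = 0 by rewrite /a /ramp; case: leP => ?; lra.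
  by rewrite !scale0r !add0r scale1r.
(* [X] and [Z] have real entries and act as the identity on the internal space, so they commute with
   time reversal; the path inherits the symmetry of [H] as a whole, without splitting [H] into
   components. *)
- move=> Hsym s _ k.
  have -> : bdg (affine (a s) (c s) H0) (affine (a s) 0 HM)
                (affine (a s) (b s) D1) (affine (a s) 0 D2) = fun k =>
      (a s)%:C *: bdg H0 HM D1 D2 k + ((b s)%:C *: tensmx (tau_x R) 1%:M +
                                       (c s)%:C *: tensmx (tau_z R) 1%:M).
    by apply/funext => q; rewrite bdg_affineE.
  rewrite tr_conj_comb ?Hsym//.
    by rewrite tensmx_unit ?unitmx1// -lt0n.
  rewrite map_mxD !map_conjZ ?real_complex_real// !map_mxT tau_x_real tau_z_real.
  rewrite map_mx1 mulmxDr mulmxDl -!scalemxAr -!scalemxAl !tensmx_mul.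
  by rewrite !mul1mx !mulmx1.
Qed.

(** * Contraposition and exchange of the two operators by time reversal *)

Theorem theorem2 (R : realType) (d N : nat) (N_gt0 : (0 < N)%N)
    (V : 'M[R[i]]_N) (V_tr : time_reversal V)
    (H0 HM D1 D2 : 'rV[R]_d -> 'M[R[i]]_N)
    (H_bdg : bdg_data V H0 HM D1 D2)
    (EG : R) (EG_gap : energy_gap (bdg H0 HM D1 D2) EG) (EG_gt0 : 0 < EG)
    (H_nontrivial : ~ topologically_trivial V (bdg H0 HM D1 D2)) :
  (exists2 a : R[i], has_eigenvalue (fun k => D1 k + HM k) a & a <= (- EG)%:C) /\
  (exists2 a : R[i], has_eigenvalue (fun k => D1 k - HM k) a & a <= (- EG)%:C).
Proof.
have Vu := unitarymx_unit V_tr.1.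
have [_ [_ oM] [_ e1] _] := H_bdg.
pose P (B : 'rV[R]_d -> 'M[R[i]]_N) :=
  exists2 a : R[i], has_eigenvalue (fun k => D1 k + B k) a & a <= (- EG)%:C.
have partner B : tr_odd V B -> P B -> P (fun k => - B k).
  move=> oB [a ev aE].
  (* Being comparable with a real number already forces [a] to be real. *)
  have ar : a \is Num.real by rewrite (ler_real aE) real_complex_real.
  exists a; [exact (tr_partner_eigenvalue Vu e1 oB ar ev)|exact aE].
have oNM : tr_odd V (fun k => - HM k).
  by move=> k; rewrite -oM /tr_conj map_mxN mulmxN mulNmx.
have PNN : P (fun k => - - HM k) -> P HM.
  by move=> [a [k ev] aE]; exists a => //; exists k; rewrite opprK in ev.
(* If [P HM] fails, then so does [P] for [- HM], as [partner] applied to the odd map [- HM] would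
   give [P HM] back; both spectral hypotheses of triviality then hold. *)
have PM : P HM.
  apply: contrapT => nPM; apply: H_nontrivial.
  apply: topologically_trivial_bdg (ltW EG_gt0) EG_gap.2 _ _ => //.
    by move=> l ev; apply/negP => lE; apply: nPM; exists l.
  move=> l ev; apply/negP => lE; apply: nPM; apply: PNN; apply: partner => //.
  by exists l.
by split; [exact PM|exact (partner _ oM PM)].
Qed.
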